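(* Let $X$ be a complex Banach space, $1\leq q<\infty$ and $\lambda\geq1$. Then for all $1\leq p_1,q_1<\infty$ and every $n\in\mathbb{N}$, $$\frac{R_{p_1,q_1}(\mathbb{D},X,\lambda)}{n}\ \leq\ A_{p_1,q_1}(B_{\ell^n_q},X,\lambda)\ \leq\ \left(\frac{R_{p_1,q_1}(\mathbb{D},X,\lambda)}{n}\right)^{1/q}.$$
   Context: $\mathbb{D}$ is the open unit disk in $\mathbb{C}$ and $B_{\ell^n_q}=\{z\in\mathbb{C}^n:(\sum_{i=1}^n|z_i|^q)^{1/q}<1\}$. For $\Omega=\mathbb{D}$ (with $n=1$) or $\Omega=B_{\ell^n_q}$ and holomorphic $f:\Omega\to X$, write $f(z)=\sum_{\alpha\in\mathbb{N}_0^n}x_\alpha(f)z^\alpha$ with $x_\alpha(f)\in X$, where $\mathbb{N}_0=\mathbb{N}\cup\{0\}$, $x_0(f)=f(0)$, and $\|f\|_\Omega=\sup_{z\in\Omega}\|f(z)\|\in[0,\infty]$. $R_{p_1,q_1}(\mathbb{D},X,\lambda)$ is the supremum of all $r\in[0,1]$ such that $$\sup_{z\in r\mathbb{D}}\left(\|x_0(f)\|^{p_1}+\left(\sum_{k=1}^\infty\|x_k(f)z^k\|\right)^{q_1}\right)\leq\lambda\|f\|_{\mathbb{D}}$$ for all holomorphic $f:\mathbb{D}\to X$. $A_{p_1,q_1}(B_{\ell^n_q},X,\lambda)$, the $\lambda_{p_1,q_1}$-arithmetic Bohr radius of $B_{\ell^n_q}$ with respect to bounded holomorphic maps, is the supremum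 of $\frac1n\sum_{i=1}^n r_i$ over all $r=(r_1,\dots,r_n)\in\mathbb{R}^n$ with all $r_i\geq0$ such that $$\|x_0(f)\|^{p_1}+\left(\sum_{m=1}^\infty\sum_{|\alpha|=m}\|x_\alpha(f)\|r^\alpha\right)^{q_1}\leq\lambda\|f\|_{B_{\ell^n_q}}$$ for all bounded holomorphic $f:B_{\ell^n_q}\to X$.
   Formalization: The formal theorem assumes X ≠ {0}; for X = {0} every inequality reads 0 ≤ 0, so R = 1 and A = +∞, and the stated upper bound fails. *)

(* Defs.v *)
From HB Require Import structures.
From mathcomp Require Import all_boot all_order all_algebra.
From mathcomp Require Import complex.
From mathcomp Require Import all_classical all_reals all_analysis.

Set Implicit Arguments.
Unset Strict Implicit.
Unset Printing Implicit Defensive.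

Import Order.TTheory GRing.Theory Num.Theory.
Import numFieldNormedType.Exports.

Local Open Scope classical_set_scope.
Local Open Scope ring_scope.

(* The norm of a normed module over R[i] takes values in R[i] (with zero
   imaginary part); rnorm is the corresponding real number. *)
Definition rnorm (R : realType) (V : normedModType R[i]) (v : V) : R :=
  complex.Re `|v|.

(* R[i]^o is R[i] seen as a normed module over itself. *)
Definition unit_disk (R : realType) : set R[i]^o := [set z | rnorm z < 1].
Arguments unit_disk : clear implicits.

Definition scaled_disk (R : realType) (r : R) : set R[i]^o :=
  [set (r%:C)%C * w | w in unit_disk R].

Definition lq_ball (R : realType) (n : nat) (q : R) : set 'rV[R[i]]_n :=
  [set z | (\sum_(i < n) rnorm (z 0 i : R[i]^o) `^ q) `^ q^-1 < 1].
Arguments lq_ball : clear implicits.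

(* Complex Frechet differentiability at every point; the (sup-)norm carried by
   'rV[R[i]]_n is irrelevant since all norms on C^n are equivalent. *)
Definition holomorphic_on (R : realType) (V W : normedModType R[i])
    (Omega : set V) (f : V -> W) : Prop :=
  forall z, Omega z -> differentiable f z.

Definition supnorm (R : realType) (V W : normedModType R[i])
    (Omega : set V) (f : V -> W) : \bar R :=
  ereal_sup [set (rnorm (f z))%:E | z in Omega].

Definition mdegree (n : nat) (a : {ffun 'I_n -> nat}) : nat :=
  (\sum_(i < n) a i)%N.

Definition mindex (n m : nat) : set {ffun 'I_n -> nat} :=
  [set a | mdegree a = m].
Arguments mindex : clear implicits.

Definition monomial (K : comNzRingType) (n : nat) (z : 'rV[K]_n)
    (a : {ffun 'I_n -> nat}) : K :=
  \prod_(i < n) z 0 i ^+ a i.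

(* x is the (unique) family of coefficients of the power series of f:
   f z = \sum_k x_k z^k on the unit disk. *)
Definition disk_expansion (R : realType) (X : normedModType R[i])
    (f : R[i]^o -> X) (x : nat -> X) : Prop :=
  forall z : R[i]^o, unit_disk R z ->
    series (fun k => z ^+ k *: x k) @ \oo --> f z.

(* x is the (unique) family of coefficients of the monomial expansion
   f z = \sum_a x_a z^a on the ball, summed by total degree as
   \sum_m \sum_(|a| = m) x_a z^a. *)
Definition ball_expansion (R : realType) (n : nat) (q : R)
    (X : normedModType R[i]) (f : 'rV[R[i]]_n -> X)
    (x : {ffun 'I_n -> nat} -> X) : Prop :=
  forall z, lq_ball R n q z ->
    series (fun m => \sum_(a \in mindex n m) monomial z a *: x a) @ \oo --> f z.

(* The admissible set may be empty (e.g. if p1 > 1); as a supremum of a subset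
   of [0, 1] it is then 0, which is the value of sup set0. *)
Definition bohr_radius (R : realType) (X : normedModType R[i])
    (p1 q1 lambda : R) : R :=
  sup [set r : R | 0 <= r <= 1 /\
    forall (f : R[i]^o -> X) (x : nat -> X),
      holomorphic_on (unit_disk R) f -> disk_expansion f x ->
      (ereal_sup [set ((rnorm (x 0%N) `^ p1)%:E +
                       (\sum_(1 <= k <oo) (rnorm (z ^+ k *: x k))%:E) `^ q1)%E
                 | z in scaled_disk r]
       <= lambda%:E * supnorm (unit_disk R) f)%E].

(* A supremum in [0, +oo], hence 0 if no r is admissible. *)
Definition arithmetic_bohr_radius (R : realType) (n : nat) (q : R)
    (X : normedModType R[i]) (p1 q1 lambda : R) : \bar R :=
  Order.max 0%E (ereal_sup
    [set ((\sum_(i < n) r 0 i) / n%:R)%:E | r in [set r : 'rV[R]_n |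
      (forall i, 0 <= r 0 i) /\
      forall (f : 'rV[R[i]]_n -> X) (x : {ffun 'I_n -> nat} -> X),
        holomorphic_on (lq_ball R n q) f ->
        (supnorm (lq_ball R n q) f < +oo)%E ->
        ball_expansion q f x ->
        ((rnorm (x [ffun=> 0%N]) `^ p1)%:E +
          (\sum_(1 <= m <oo)
             (\sum_(a \in mindex n m) rnorm (x a) * monomial r a)%:E) `^ q1
         <= lambda%:E * supnorm (lq_ball R n q) f)%E]]).

(* Main.v *)
Require Import Defs.
From mathcomp Require Import finmap.
From mathcomp Require Import all_boot all_order all_algebra.
From mathcomp Require Import complex.
From mathcomp Require Import all_classical all_reals all_analysis.
Import Order.TTheory GRing.Theory Num.Theory.
Import numFieldNormedType.Exports.
Local Open Scope classical_set_scope.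
Local Open Scope ring_scope.

(* Lower bound: restricting f to the first coordinate axis turns its expansion
   into that of a function on the disk, so r = (s, 0, ..., 0) is admissible for
   the ball whenever s lies below the Bohr radius of the disk.  Upper bound: let
   r be admissible for the ball and t = |r|_q.  By duality some nonnegative
   linear form phi maps the ball into the disk and satisfies phi(r) = t.  The
   multinomial coefficients of f o phi are nonnegative multiples of those of f,
   so Bohr's inequality for f o phi at r is the one for f at t; testing it on
   powers z^k v forces t <= 1, hence t is at most the Bohr radius K.  The power
   mean inequality bounds the mean of the r_i by t / n^(1/q), and
   t <= K <= K^(1/q). *)

(** * Real-valued norms on modules over [R[i]] *)

Lemma normE_rnorm {R : realType} {V : normedModType R[i]} (v : V) : `|v| = (rnorm v)%:C%C.
Proof.
rewrite /rnorm; have := normr_ge0 v.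
by case: `|v| => a b; rewrite lecE /= => /andP[/eqP -> _].
Qed.

Section Rnorm.
Context {R : realType} {V : normedModType R[i]}.
Implicit Types (v : V) (z : R[i]).

Lemma rnorm_ge0 v : 0 <= rnorm v.
Proof. by rewrite -lecR -normE_rnorm normr_ge0. Qed.

Lemma rnorm_eq0 v : (rnorm v == 0) = (v == 0).
Proof. by rewrite -[RHS]normr_eq0 normE_rnorm -(inj_eq (@complexI R)). Qed.

Lemma rnorm0 : rnorm (0 : V) = 0.
Proof. by apply/eqP; rewrite rnorm_eq0. Qed.

Lemma rnormZ z v : rnorm (z *: v) = rnorm (z : R[i]^o) * rnorm v.
Proof.
apply: (@complexI R).
by rewrite rmorphM /= -normE_rnorm normrZ (normE_rnorm v)
  -(normE_rnorm (z : R[i]^o)).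
Qed.

Lemma ler_rnorm_sum n (F : 'I_n -> V) :
  rnorm (\sum_i F i) <= \sum_i rnorm (F i).
Proof.
rewrite -lecR -normE_rnorm rmorph_sum /=.
apply: (le_trans (ler_norm_sum _ _ _)).
by apply: ler_sum => i _; rewrite normE_rnorm.
Qed.

End Rnorm.

Section RnormC.
Context {R : realType}.
Implicit Types (z : R[i]).

Lemma rnormM z w : rnorm (z * w : R[i]^o) = rnorm (z : R[i]^o) * rnorm (w : R[i]^o).
Proof. exact: (@rnormZ R R[i]^o). Qed.

Lemma rnormX z k : rnorm (z ^+ k : R[i]^o) = rnorm (z : R[i]^o) ^+ k.
Proof.
apply: (@complexI R); rewrite rmorphXn /= -!normE_rnorm.
exact: normrX.
Qed.

Lemma rnorm_real (x : R) : 0 <= x -> rnorm (x%:C%C : R[i]^o) = x.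
Proof.
move=> x0; apply: (@complexI R).
by rewrite -normE_rnorm [LHS](ger0_norm _) // lecR.
Qed.

End RnormC.

(** * Young's inequality and its consequences for finite sums *)

Section Young.
Context {R : realType}.

Lemma young_powR (a b q : R) : 0 <= a -> 0 <= b -> 1 <= q ->
  a * b `^ (q - 1) <= a `^ q / q + (1 - q^-1) * b `^ q.
Proof.
move=> a0 b0; rewrite le_eqVlt => /predU1P[<-|q1].
  by rewrite subrr powRr0 invr1 subrr mul0r addr0 !mulr1 powRr1.
have q0 : 0 < q by apply: lt_trans q1.
have q1' : 0 < q - 1 by rewrite subr_gt0.
have p0 : 0 < q / (q - 1) by rewrite divr_gt0.
have := @conjugate_powR R a (b `^ (q - 1)) q (q / (q - 1)) a0 (powR_ge0 _ _) q0 p0.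
rewrite -powRrM mulrCA divff ?gt_eqF// mulr1 invf_div.
rewrite mulrBl divff ?gt_eqF// mul1r [b `^ q * _]mulrC.
by apply; rewrite addrC subrK.
Qed.

Lemma sum_young_powR n (a b : 'I_n -> R) (q : R) :
  (forall i, 0 <= a i) -> (forall i, 0 <= b i) -> 1 <= q ->
  \sum_i a i * b i `^ (q - 1) <=
  (\sum_i a i `^ q) / q + (1 - q^-1) * \sum_i b i `^ q.
Proof.
move=> a0 b0 q1; rewrite mulr_suml mulr_sumr -big_split /=.
by apply: ler_sum => i _; exact: young_powR.
Qed.

(** The duality estimate: the form with coefficients b_i^(q-1) maps the open ball into the disk.
    With A the sum of the a_i^q, Young bounds the left side by A/q + 1 - 1/q, which is below 1
    because A < 1. *)
Lemma holder_lt1 n (a b : 'I_n -> R) (q : R) :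
  (forall i, 0 <= a i) -> (forall i, 0 <= b i) -> 1 <= q ->
  (\sum_i a i `^ q) `^ q^-1 < 1 -> \sum_i b i `^ q = 1 ->
  \sum_i a i * b i `^ (q - 1) < 1.
Proof.
move=> a0 b0 q1 a1 b1; have q0 : 0 < q by apply: lt_le_trans q1.
have S0 : 0 <= \sum_i a i `^ q by apply: sumr_ge0 => i _; exact: powR_ge0.
apply: (le_lt_trans (sum_young_powR _ _ _ _ a0 b0 q1)).
rewrite b1 mulr1 addrCA gtrDl subr_lt0 ltr_pdivrMr// mulVf ?gt_eqF//.
apply: contraTT a1; rewrite -!leNgt => S1.
have <- : 1 `^ q^-1 = 1 :> R by rewrite powR1.
by rewrite ge0_ler_powR ?nnegrE ?invr_ge0 ?ler01 ?(ltW q0).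
Qed.

(* Young's inequality applied to each [r i] against the claimed bound. *)
Lemma power_mean n (r : 'I_n -> R) (q t : R) : (0 < n)%N ->
  (forall i, 0 <= r i) -> 1 <= q -> 0 < t -> \sum_i r i `^ q = t `^ q ->
  (\sum_i r i) / n%:R <= t * n%:R^-1 `^ q^-1.
Proof.
move=> n0 r0 q1 t0 rt; set c := t * _.
have q0 : 0 < q by apply: lt_le_trans q1.
have n0' : 0 < n%:R :> R by rewrite ltr0n.
have c0 : 0 < c by rewrite mulr_gt0 ?powR_gt0 ?invr_gt0.
(* The constant vector c has the same l^q norm t as r, so the right side of Young's inequality
   collapses to t^q = n c^q; dividing by n c^(q-1) bounds the mean by c. *)
have cq : c `^ q = t `^ q / n%:R.
  rewrite /c (powRM _ (ltW t0) (powR_ge0 _ _)) -powRrM mulVf ?gt_eqF//.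
  by rewrite powRr1 ?invr_ge0 ?ler0n.
have := @sum_young_powR n r (fun=> c) q r0 (fun=> ltW c0) q1.
rewrite -mulr_suml rt sumr_const card_ord cq -(mulr_natr (_ / _)).
rewrite mulfVK ?gt_eqF//.
rewrite [_ / q]mulrC -mulrDl (addrC q^-1) subrK mul1r => le_t.
rewrite ler_pdivrMr// -(ler_pM2r (powR_gt0 (q - 1) c0)).
by rewrite mulrAC (mulr_powRB1 (ltW c0) q0) cq mulfVK ?gt_eqF.
Qed.

End Young.

(** * Multi-indices and the multinomial theorem *)

Section Multinomial.
Context {n : nat}.

Lemma finite_mindex m : finite_set (mindex n m).
Proof.
apply: (@sub_finite_set _ _
  ((fun b : {ffun 'I_n -> 'I_m.+1} => [ffun i => val (b i)]) @` setT)); last first.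
  exact: finite_image.
move=> a /= am.
have lt_am i : (a i < m.+1)%N.
  by rewrite ltnS -am /mdegree (bigD1 i)//= leq_addr.
by exists [ffun i => Ordinal (lt_am i)] => //; apply/ffunP => i; rewrite !ffunE.
Qed.

Definition occurrences {m} (h : {ffun 'I_m -> 'I_n}) : {ffun 'I_n -> nat} :=
  [ffun i => #|[pred j | h j == i]|].

(* The multinomial coefficient, as a number of words. *)
Definition multiplicity m (a : {ffun 'I_n -> nat}) : nat :=
  #|[pred h : {ffun 'I_m -> 'I_n} | occurrences h == a]|.

Lemma mdegree_occurrences m (h : {ffun 'I_m -> 'I_n}) :
  mdegree (occurrences h) = m.
Proof.
rewrite /mdegree -[RHS]card_ord -sum1_card (partition_big h xpredT)//=.
by apply: eq_bigr => i _; rewrite ffunE -sum1_card; apply: eq_bigl.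
Qed.

(** Multinomial theorem: the power expands into a sum over words of length m in the n variables, and
    words with the same letter counts give the same monomial. *)
Lemma expr_sum_monomial (K : comNzRingType) m (z : 'rV[K]_n) :
  (\sum_i z 0 i) ^+ m =
  \sum_(a \in mindex n m) (multiplicity m a)%:R * monomial z a.
Proof.
rewrite -[in LHS](card_ord m) -prodr_const bigA_distr_bigA /=.
rewrite fsbig_finite /=; last exact: finite_mindex.
transitivity (\sum_(h : {ffun 'I_m -> 'I_n}) monomial z (occurrences h)).
  apply: eq_bigr => h _; rewrite (partition_big h xpredT)//=.
  apply: eq_bigr => i _; rewrite ffunE -prodr_const.
  by apply: eq_big => //= j /eqP ->.
transitivity (\sum_(a <- fset_set (mindex n m))
    \sum_(h : {ffun 'I_m -> 'I_n} | occurrences h == a)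
       monomial z (occurrences h)); last first.
  apply: eq_bigr => a _; rewrite mulr_natl -sumr_const.
  by apply: eq_big => //= h /eqP ->.
rewrite (exchange_big_dep xpredT)//=; apply: eq_bigr => h _.
rewrite (eq_bigl (pred1 (occurrences h))); last by move=> a; rewrite eq_sym.
rewrite -big_filter filter_pred1_uniq ?big_seq1 ?fset_uniq//.
have : occurrences h \in fset_set (mindex n m).
  by rewrite in_fset_set ?inE; [exact: mdegree_occurrences|exact: finite_mindex].
by [].
Qed.

Lemma monomialM (K : comNzRingType) (z w : 'rV[K]_n) a :
  monomial (\row_i (z 0 i * w 0 i)) a = monomial z a * monomial w a.
Proof.
by rewrite /monomial -big_split; apply: eq_bigr => i _; rewrite mxE exprMn.
Qed.

Definition axis_index (i0 : 'I_n) (m : nat) : {ffun 'I_n -> nat} :=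
  [ffun i => if i == i0 then m else 0%N].

(** Any other index of degree m has a nonzero entry off [i0], where the axis vector vanishes. Stated
    over a general ring, to serve both for coefficients in X and for their real norms. *)
Lemma monomial_axis (K : comNzRingType) (V : lmodType K) (i0 : 'I_n) m (w : K)
    (x : {ffun 'I_n -> nat} -> V) :
  \sum_(a \in mindex n m) monomial (w *: delta_mx 0 i0) a *: x a =
  w ^+ m *: x (axis_index i0 m).
Proof.
rewrite -(fsbig_widen [set axis_index i0 m]); last 2 first.
- move=> a ->; rewrite /mindex/= /mdegree (bigD1 i0)//= big1 ?addn0.
    by rewrite ffunE eqxx.
  by move=> i /negPf ii0; rewrite ffunE ii0.
- move=> a [/= am /eqP aNe].
  have [i ii0 ai] : exists2 i, i != i0 & a i != 0%N.
    apply/not_exists2P => a0; move/eqP: aNe; apply.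
    have a0' i : i != i0 -> a i = 0%N.
      by move=> ii0; have [//|/negP/negPn/eqP] := a0 i.
    apply/ffunP => i; rewrite ffunE; case: eqVneq => [->|/a0'//].
    by rewrite -am /mdegree (bigD1 i0)//= big1 ?addn0.
  rewrite /monomial (bigD1 i)//= !mxE (negPf ii0) andbF mulr0 expr0n (negPf ai).
  by rewrite mul0r scale0r.
rewrite fsbig_set1 /monomial (bigD1 i0)//= !mxE ffunE !eqxx mulr1.
rewrite big1 ?mulr1// => i /negPf ii0.
by rewrite ffunE ii0 expr0.
Qed.

End Multinomial.

(** * Restriction of functions on the ball to a coordinate axis *)

Section Axis.
Context {R : realType} {n : nat}.
Implicit Types (w : R[i]^o) (q : R).

Lemma lq_ball_axis q (i0 : 'I_n) w : 0 < q ->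
  unit_disk R w -> lq_ball R n q (w *: delta_mx 0 i0).
Proof.
move=> q0; rewrite /unit_disk /lq_ball /= => w1.
rewrite (bigD1 i0)//= !mxE !eqxx mulr1 big1 ?addr0.
  by rewrite -powRrM mulfV ?gt_eqF// powRr1 ?rnorm_ge0.
by move=> i /negPf ii0; rewrite !mxE ii0 andbF mulr0 rnorm0 powR0 ?gt_eqF.
Qed.

Context {X : normedModType R[i]}.

Lemma holomorphic_axis q (i0 : 'I_n) (f : 'rV[R[i]]_n -> X) : 0 < q ->
  holomorphic_on (lq_ball R n q) f ->
  holomorphic_on (unit_disk R) (fun w => f (w *: delta_mx 0 i0)).
Proof.
move=> q0 hf w w1.
apply: (differentiable_comp (f := fun w : R[i]^o => w *: delta_mx 0 i0)).
  exact: (@differentiableZl _ _ _ id).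
exact/hf/lq_ball_axis.
Qed.

Lemma expansion_axis q (i0 : 'I_n) (f : 'rV[R[i]]_n -> X) x : 0 < q ->
  ball_expansion q f x ->
  disk_expansion (fun w => f (w *: delta_mx 0 i0))
    (fun m => x (axis_index i0 m)).
Proof.
move=> q0 fx w w1; have := fx _ (lq_ball_axis q i0 w q0 w1).
by under eq_fun do rewrite monomial_axis.
Qed.

Lemma supnorm_axis q (i0 : 'I_n) (f : 'rV[R[i]]_n -> X) : 0 < q ->
  (supnorm (unit_disk R) (fun w => f (w *: delta_mx 0%R i0))
     <= supnorm (lq_ball R n q) f)%E.
Proof.
move=> q0; apply: ereal_sup_le => _ [w w1 <-].
by exists (w *: delta_mx 0 i0) => //; exact: lq_ball_axis.
Qed.

End Axis.

(** * Composition with a nonnegative linear form from the ball to the disk *)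

Section Form.
Context {R : realType} {n : nat} {q : R} {phi : 'rV[R]_n}.
Hypothesis phi_ge0 : forall i, 0 <= phi 0 i.
Hypothesis phi_lt1 : forall z : 'rV[R[i]]_n, lq_ball R n q z ->
  \sum_i rnorm (z 0 i : R[i]^o) * phi 0 i < 1.

Definition form (z : 'rV[R[i]]_n) : R[i]^o := \sum_i z 0 i * (phi 0 i)%:C%C.

Lemma form_disk z : lq_ball R n q z -> unit_disk R (form z).
Proof.
move=> /phi_lt1; apply: le_lt_trans.
apply: (le_trans (ler_rnorm_sum _ _)); apply: ler_sum => i _.
by rewrite rnormM rnorm_real.
Qed.

Lemma monomial_real (r : 'rV[R]_n) a :
  monomial (map_mx (real_complex R) r) a = (monomial r a)%:C%C.
Proof.
by rewrite /monomial rmorph_prod; apply: eq_bigr => i _; rewrite mxE rmorphXn.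
Qed.

Lemma differentiable_form z : differentiable form z.
Proof.
rewrite (_ : form =
  \sum_i (fun z : 'rV[R[i]]_n => z 0 i *: ((phi 0 i)%:C%C : R[i]^o))).
  apply: differentiable_sum => i; apply: differentiableZl.
  exact: differentiable_coord.
by apply/funext => w; rewrite /form fct_sumE.
Qed.

Context {X : normedModType R[i]}.
Implicit Types (f : R[i]^o -> X) (x : nat -> X).

(** Obtained by expanding each form(z)^m x_m with the multinomial theorem. *)
Definition form_coef x (a : {ffun 'I_n -> nat}) : X :=
  ((multiplicity (mdegree a) a)%:R * monomial phi a)%:C%C *: x (mdegree a).

Lemma holomorphic_form f :
  holomorphic_on (unit_disk R) f -> holomorphic_on (lq_ball R n q) (f \o form).
Proof.
move=> hf z zq; apply: differentiable_comp (differentiable_form z) _.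
exact/hf/form_disk.
Qed.

Lemma expansion_form f x :
  disk_expansion f x -> ball_expansion q (f \o form) (form_coef x).
Proof.
move=> fx z zq; have := fx _ (form_disk _ zq).
rewrite (_ : (fun k => form z ^+ k *: x k) =
  (fun m => \sum_(a \in mindex n m) monomial z a *: form_coef x a))//.
apply/funext => m.
rewrite [form z](_ : _ =
  \sum_i (\row_i (z 0 i * map_mx (real_complex R) phi 0 i)) 0 i); last first.
  by apply: eq_bigr => i _; rewrite !mxE.
rewrite expr_sum_monomial !fsbig_finite/=; [|exact: finite_mindex..].
rewrite scaler_suml [LHS]big_seq [RHS]big_seq; apply: eq_bigr => a.
rewrite in_fset_set ?inE /= => [am|]; last exact: finite_mindex.
rewrite /form_coef am scalerA monomialM monomial_real rmorphM rmorph_nat.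
by congr (_ *: _); rewrite mulrCA.
Qed.

Lemma supnorm_form f :
  (supnorm (lq_ball R n q) (f \o form) <= supnorm (unit_disk R) f)%E.
Proof.
apply: ereal_sup_le => _ [z zq <-].
by exists (form z) => //; exact: form_disk.
Qed.

Lemma rnorm_form_coef x a : rnorm (form_coef x a) =
  (multiplicity (mdegree a) a)%:R * monomial phi a * rnorm (x (mdegree a)).
Proof.
rewrite /form_coef rnormZ rnorm_real// mulr_ge0 ?ler0n//.
by apply: prodr_ge0 => i _; exact: exprn_ge0.
Qed.

(** The scalars in [form_coef] are nonnegative, so taking norms loses nothing and the multinomial
    theorem can be read backwards: an equality, not just a bound. *)
Lemma sum_rnorm_form_coef x (r : 'rV[R]_n) m :
  \sum_(a \in mindex n m) rnorm (form_coef x a) * monomial r a =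
  rnorm (x m) * (\sum_i phi 0 i * r 0 i) ^+ m.
Proof.
transitivity (rnorm (x m) *
  (\sum_i (\row_i (phi 0 i * r 0 i)) 0 i) ^+ m); last first.
  by congr (_ * _ ^+ _); apply: eq_bigr => i _; rewrite mxE.
rewrite expr_sum_monomial !fsbig_finite/=; [|exact: finite_mindex..].
rewrite mulr_sumr [LHS]big_seq [RHS]big_seq; apply: eq_bigr => a.
rewrite in_fset_set ?inE /= => [am|]; last exact: finite_mindex.
by rewrite rnorm_form_coef am monomialM [_ * rnorm _]mulrC -!mulrA.
Qed.

(** Degree 0 of the previous identity, where the zero index is the only one. *)
Lemma form_coef0 x : rnorm (form_coef x [ffun=> 0%N]) = rnorm (x 0%N).
Proof.
have := sum_rnorm_form_coef x (const_mx 0) 0.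
rewrite expr0 mulr1.
have -> : mindex n 0 = [set [ffun=> 0%N]].
  apply/seteqP; split => a /=; last first.
    by move=> ->; rewrite /mindex/= /mdegree big1// => i _; rewrite ffunE.
  rewrite /mindex/= /mdegree => /eqP; rewrite sum_nat_eq0 => /forallP a0.
  by apply/ffunP => i; rewrite ffunE; exact/eqP/a0.
rewrite fsbig_set1 /monomial big1 ?mulr1// => i _.
by rewrite ffunE expr0.
Qed.

End Form.

(** * The test functions z^k v *)

Section MonomialTest.
Context {R : realType} {X : normedModType R[i]}.
Implicit Types v : X.

Lemma holomorphic_power k v (Omega : set R[i]^o) :
  holomorphic_on Omega (fun w : R[i]^o => w ^+ k.+1 *: v : X).
Proof.
move=> w _; apply: (@differentiableZl _ _ _ (fun w : R[i]^o => w ^+ k.+1)).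
have := @differentiableX R[i] R[i]^o id k w.
by rewrite exprfctE; apply; exact: ex_diff.
Qed.

Lemma expansion_power k v :
  disk_expansion (fun w => w ^+ k *: v) (fun j => if j == k then v else 0).
Proof.
move=> z _; apply: cvg_near_cst; near=> N; rewrite /series /=.
have kN : (k < N)%N by near: N; exact: nbhs_infty_gt.
rewrite (bigD1_seq k) ?mem_index_iota ?iota_uniq//= eqxx big1 ?addr0//.
by move=> j /negPf ->; rewrite scaler0.
Unshelve. all: by end_near. Qed.

Lemma supnorm_power k v :
  (supnorm (unit_disk R) (fun w => w ^+ k *: v) <= (rnorm v)%:E)%E.
Proof.
apply: ge_ereal_sup => _ [w w1 <-]; rewrite lee_fin rnormZ rnormX.
by rewrite ler_piMl ?rnorm_ge0// exprn_ile1 ?rnorm_ge0 // ltW.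
Qed.

End MonomialTest.

Lemma expr_unbounded {R : realType} (t C : R) : 1 < t ->
  exists k, C < t ^+ k.+1.
Proof.
move=> t1; have t0 : 0 < t by apply: lt_trans t1.
have C1 : 0 < `|C| + 1 by rewrite ltr_wpDl.
have : `|t^-1| < 1 by rewrite gtr0_norm ?invr_gt0// invf_lt1.
move=> /cvg_expr /cvgrPdist_lt /(_ (`|C| + 1)^-1).
(* The powers of 1/t tend to 0; taking rank N + 1 makes the exponent positive. *)
rewrite invr_gt0 C1 => /(_ erefl) [N _ /(_ N.+1 (leqnSn _))] /=.
rewrite sub0r normrN ger0_norm; last by rewrite exprn_ge0// invr_ge0 ltW.
rewrite exprVn ltf_pV2 ?posrE ?exprn_gt0// => lt_tN; exists N.
by apply: le_lt_trans lt_tN; rewrite (le_trans (ler_norm C))// lerDl.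
Qed.

(** * Transfer of admissibility between the disk and the ball *)

Section Admissible.
Context {R : realType} (X : normedModType R[i]) (p1 q1 lambda : R).

(** This and [ball_admissible] repeat the inequalities inside the two radii, so membership there
    converts to them. *)
Definition disk_admissible (r : R) : Prop :=
  forall (f : R[i]^o -> X) (x : nat -> X),
    holomorphic_on (unit_disk R) f -> disk_expansion f x ->
    (ereal_sup [set ((rnorm (x 0%N) `^ p1)%:E +
                     (\sum_(1 <= k <oo) (rnorm (z ^+ k *: x k))%:E) `^ q1)%E
               | z in scaled_disk r]
     <= lambda%:E * supnorm (unit_disk R) f)%E.

Definition ball_admissible {n : nat} (q : R) (r : 'rV[R]_n) : Prop :=
  forall (f : 'rV[R[i]]_n -> X) (x : {ffun 'I_n -> nat} -> X),
    holomorphic_on (lq_ball R n q) f ->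
    (supnorm (lq_ball R n q) f < +oo)%E ->
    ball_expansion q f x ->
    ((rnorm (x [ffun=> 0%N]) `^ p1)%:E +
      (\sum_(1 <= m <oo)
         (\sum_(a \in mindex n m) rnorm (x a) * monomial r a)%:E) `^ q1
     <= lambda%:E * supnorm (lq_ball R n q) f)%E.

(* [disk_admissible t] with the supremum over the open disk of radius [t]
   replaced by the value at [t], and restricted to bounded [f]. *)
Definition bohr_bound (t : R) : Prop :=
  forall (f : R[i]^o -> X) (x : nat -> X),
    holomorphic_on (unit_disk R) f -> disk_expansion f x ->
    (supnorm (unit_disk R) f < +oo)%E ->
    ((rnorm (x 0%N) `^ p1)%:E +
      (\sum_(1 <= k <oo) (rnorm (x k) * t ^+ k)%:E) `^ q1
     <= lambda%:E * supnorm (unit_disk R) f)%E.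

Hypothesis lambda_ge1 : 1 <= lambda.

(** Strictness of s < r places s = r (s/r) in the open disk of radius r, over which the supremum is
    taken. *)
Lemma ball_admissible_axis n (q r s : R) (i0 : 'I_n) : 1 <= q ->
  disk_admissible r -> 0 <= s < r -> ball_admissible q (s *: delta_mx 0 i0).
Proof.
move=> q1' rA /andP[s0 sr] f x fh _ fx.
have q0 : 0 < q by apply: lt_le_trans q1'.
have r0 : 0 < r by apply: le_lt_trans sr.
have := rA _ _ (holomorphic_axis q i0 f q0 fh) (expansion_axis q i0 f x q0 fx).
have lam0 : (0 <= lambda%:E)%E by rewrite lee_fin (le_trans _ lambda_ge1).
move/le_trans => /(_ _ (lee_wpmul2l lam0 (supnorm_axis q i0 f q0))).
apply: le_trans; apply: ereal_sup_ubound; exists (s%:C)%C.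
  exists ((s / r)%:C)%C; last by rewrite -rmorphM mulrC mulfVK ?gt_eqF.
  by rewrite /unit_disk /= rnorm_real ?divr_ge0 ?(ltW r0)// ltr_pdivrMr ?mul1r.
congr (_%:E + _)%E.
  by congr (rnorm (x _) `^ _); apply/ffunP => i; rewrite !ffunE if_same.
congr (_ `^ _)%E; apply: eq_eseriesr => m _; congr _%:E.
rewrite rnormZ rnormX rnorm_real//.
(* Read the product as a scaling in R, so that [monomial_axis] applies to the family of norms. *)
rewrite -[LHS]/(s ^+ m *: (rnorm (x (axis_index i0 m)) : R^o)).
rewrite -(monomial_axis _ R^o _ _ _ (fun a => rnorm (x a))).
by apply: eq_fsbigr => a _; rewrite mulrC.
Qed.

Lemma ball_admissible_form n (q : R) (r phi : 'rV[R]_n) :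
  (forall i, 0 <= phi 0 i) ->
  (forall z : 'rV[R[i]]_n, lq_ball R n q z ->
    \sum_i rnorm (z 0 i : R[i]^o) * phi 0 i < 1) ->
  ball_admissible q r -> bohr_bound (\sum_i phi 0 i * r 0 i).
Proof.
move=> phi0 phi1 rA f x fh fx foo.
have lef := supnorm_form phi0 phi1 f.
have := rA _ _ (holomorphic_form phi0 phi1 f fh) (le_lt_trans lef foo)
  (expansion_form phi0 phi1 f x fx).
rewrite form_coef0//.
under eq_eseriesr do rewrite sum_rnorm_form_coef//.
move/le_trans; apply.
by rewrite lee_wpmul2l// lee_fin (le_trans _ lambda_ge1).
Qed.

End Admissible.

(** * From Bohr's inequality at t to membership of t in the disk's admissible set *)

Section Bounds.
Context {R : realType} (X : normedModType R[i]) (p1 q1 lambda : R).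
Hypotheses (lambda_ge1 : 1 <= lambda) (q1_ge1 : 1 <= q1).

Lemma bohr_bound_le1 (t : R) : (exists v : X, v != 0) ->
  bohr_bound X p1 q1 lambda t -> t <= 1.
Proof.
move=> [v v0] tB; rewrite leNgt; apply/negP => t1.
have t0 : 0 <= t by rewrite ltW// (lt_trans _ t1).
have v0' : 0 < rnorm v by rewrite lt0r rnorm_eq0 v0 rnorm_ge0.
have lam0 : 0 <= lambda by apply: le_trans lambda_ge1.
(* The maximum with 1 ensures that y > C implies y^q1 >= y > C. *)
set C := Num.max 1 (lambda * rnorm v).
have [k] := expr_unbounded t (C / rnorm v) t1.
rewrite ltr_pdivrMr// mulrC => Ck.
have := tB _ _ (holomorphic_power k v _) (expansion_power k.+1 v)
  (le_lt_trans (supnorm_power k.+1 v) (ltry _)).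
apply/negP; rewrite -ltNge.
apply: (le_lt_trans (lee_wpmul2l _ (supnorm_power _ _))); first by rewrite lee_fin.
rewrite -EFinM rnorm0; set S := (\sum_(1 <= k <oo) _)%E.
(* S dominates its partial sum over 1 <= j < k + 2, whose only nonzero term is the last. *)
have leS : ((rnorm v * t ^+ k.+1)%:E <= S)%E.
  have := @nneseries_lim_ge R
    (fun j => (rnorm (if j == k.+1 then v else 0) * t ^+ j)%:E) xpredT 1 k.+2.
  rewrite big_nat_recr//= eqxx big_nat_cond big1 ?add0e; last first.
    by move=> j; rewrite andbT => /andP[_ jk]; rewrite lt_eqF// rnorm0 mul0r.
  by apply=> j _ _; rewrite lee_fin mulr_ge0 ?rnorm_ge0 ?exprn_ge0.
have lt_lS : (C%:E < S `^ q1)%E.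
  apply: (@lt_le_trans _ _ (((rnorm v * t ^+ k.+1) `^ q1)%:E)).
    rewrite lte_fin (lt_le_trans Ck)// le1r_powR//.
    by rewrite ltW// (le_lt_trans _ Ck)// le_max lexx.
  rewrite -poweR_EFin; apply: gt0_ler_poweR => //; first exact: le_trans q1_ge1.
  - by rewrite in_itv/= leey andbT lee_fin mulr_ge0 ?exprn_ge0 ?rnorm_ge0.
  - rewrite in_itv/= leey andbT (le_trans _ leS)// lee_fin.
    by rewrite mulr_ge0 ?exprn_ge0 ?rnorm_ge0.
apply: (@le_lt_trans _ _ C%:E); first by rewrite lee_fin le_max lexx orbT.
by rewrite (lt_le_trans lt_lS)// leeDr// lee_fin powR_ge0.
Qed.

Lemma disk_admissible_bohr_bound (t : R) : 0 <= t ->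
  bohr_bound X p1 q1 lambda t ->
  disk_admissible X p1 q1 lambda t.
Proof.
move=> t0 tB f x fh fx.
(* For unbounded f the right side is +oo, as lambda > 0. *)
have [foo|] := ltP (supnorm (unit_disk R) f) +oo%E; last first.
  rewrite leye_eq => /eqP ->.
  by rewrite gt0_muley ?leey// lte_fin (lt_le_trans _ lambda_ge1).
apply: ge_ereal_sup => _ [_ [w w1 <-] <-].
apply: le_trans (tB f x fh fx foo); rewrite leeD2l//.
have w1' : rnorm w <= 1 by exact: ltW.
have leS : (\sum_(1 <= k <oo) (rnorm (((t%:C)%C * w) ^+ k *: x k))%:E <=
    \sum_(1 <= k <oo) (rnorm (x k) * t ^+ k)%:E)%E.
  apply: lee_nneseries => k _; first by rewrite lee_fin rnorm_ge0.
  rewrite lee_fin rnormZ mulrC ler_wpM2l ?rnorm_ge0// rnormX rnormM rnorm_real//.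
  by rewrite exprMn ler_piMr ?exprn_ge0// exprn_ile1 ?rnorm_ge0.
have S0 : (0 <= \sum_(1 <= k <oo) (rnorm (((t%:C)%C * w) ^+ k *: x k))%:E)%E.
  by apply: nneseries_ge0 => k _ _; rewrite lee_fin rnorm_ge0.
apply: gt0_ler_poweR => //; first exact: le_trans q1_ge1.
  by rewrite in_itv/= leey andbT.
by rewrite in_itv/= leey andbT (le_trans S0).
Qed.

End Bounds.

(** * The two inequalities between the radii *)

Theorem theorem2p5 (R : realType) (X : completeNormedModType R[i])
  (X_neq0 : exists v : X, v != 0)
  (q lambda : R) (q_ge1 : 1 <= q) (lambda_ge1 : 1 <= lambda)
  (p1 q1 : R) (p1_ge1 : 1 <= p1) (q1_ge1 : 1 <= q1)
  (n : nat) (n_gt0 : (0 < n)%N) :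
  ((bohr_radius X p1 q1 lambda / n%:R)%:E
     <= arithmetic_bohr_radius n q X p1 q1 lambda)%E /\
  (arithmetic_bohr_radius n q X p1 q1 lambda
     <= ((bohr_radius X p1 q1 lambda / n%:R) `^ q^-1)%:E)%E.
Proof.
have n0 : 0 < n%:R :> R by rewrite ltr0n.
have q0 : 0 < q by apply: lt_le_trans q_ge1.
rewrite /bohr_radius /arithmetic_bohr_radius.
set D := [set r : R | _]; set B := [set _ | r in _].
split.
(* If no radius is admissible, [sup D] is 0, and the maximum with 0 on the ball side suffices. *)
- have [->|/set0P D0] := eqVneq D set0; first by rewrite sup0 mul0r le_max lexx.
  apply/lee_addgt0Pr => e e0.
  rewrite -leeBlDr// -EFinB.
  suff : (forall s, s < sup D -> ((s / n%:R)%:E <= Order.max 0 (ereal_sup B))%E).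
    (* The supremum may not be attained; lowering it by e n costs e after division by n. *)
    move=> /(_ (sup D - e * n%:R)); rewrite mulrBl mulfK ?gt_eqF//.
    by apply; rewrite ltrBlDr ltrDl mulr_gt0.
  move=> s /(sup_gt D0)[r [/andP[r0 _] rD] sr].
  have [s0|s0] := ltP s 0.
    by rewrite le_max lee_fin pmulr_lle0 ?invr_gt0// (ltW s0).
  rewrite le_max; apply/orP; right; apply: ereal_sup_ubound.
  have i0 := Ordinal n_gt0.
  exists (s *: delta_mx 0 i0); last first.
    congr (_ / _)%:E; rewrite (bigD1 i0)//= !mxE !eqxx mulr1 big1 ?addr0//.
    by move=> i /negPf ii0; rewrite !mxE ii0 andbF mulr0.
  split; first by move=> i; rewrite !mxE mulr_ge0// ler0n.
  by apply: (ball_admissible_axis X p1 q1 lambda lambda_ge1) rD _; rewrite ?s0.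
rewrite ge_max lee_fin powR_ge0/=; apply: ge_ereal_sup => _ [r [r0 rB] <-].
rewrite lee_fin; set T := \sum_i (r 0 i) `^ q.
have T0 : 0 <= T by apply: sumr_ge0 => i _; exact: powR_ge0.
(* T = 0 forces r = 0, which cannot be normalized; its mean is 0. *)
have [TE|Tneq0] := eqVneq T 0.
  rewrite big1 ?mul0r ?powR_ge0// => i _; apply/eqP.
  move/eqP: TE; rewrite psumr_eq0; last by move=> j _; exact: powR_ge0.
  by move=> /allP /(_ i (mem_index_enum _)) /=; rewrite powR_eq0 => /andP[].
set t := T `^ q^-1.
have t0 : 0 < t by rewrite powR_gt0// lt0r Tneq0.
have Tt : T = t `^ q by rewrite /t -powRrM mulVf ?gt_eqF// powRr1.
(* The norming functional of r: phi(r) is t times the sum of the (r_i/t)^q, which is 1. *)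
pose phi : 'rV[R]_n := \row_i (r 0 i / t) `^ (q - 1).
have rho1 : \sum_i (r 0 i / t) `^ q = 1.
  transitivity (T / t `^ q); last by rewrite -Tt divff.
  rewrite mulr_suml; apply: eq_bigr => i _.
  rewrite powRM ?invr_ge0 ?(ltW t0)// -powR_inv1 ?(ltW t0)//.
  by rewrite powRAC powR_inv1 ?powR_ge0.
have phi0 i : 0 <= phi 0 i by rewrite mxE powR_ge0.
have phi1 (z : 'rV[R[i]]_n) : lq_ball R n q z ->
    \sum_i rnorm (z 0 i : R[i]^o) * phi 0 i < 1.
  move=> zq; under eq_bigr do rewrite mxE.
  apply: holder_lt1 q_ge1 zq rho1 => i; first exact: rnorm_ge0.
  by rewrite divr_ge0// ltW.
have phir : \sum_i phi 0 i * r 0 i = t.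
  transitivity (t * \sum_i (r 0 i / t) `^ q); last by rewrite rho1 mulr1.
  rewrite mulr_sumr; apply: eq_bigr => i _.
  rewrite -(@mulr_powRB1 _ (r 0 i / t) q) ?divr_ge0 ?(ltW t0)// mxE mulrA.
  by rewrite [t * _]mulrC mulfVK ?gt_eqF// mulrC.
have tB : bohr_bound X p1 q1 lambda t.
  rewrite -phir.
  exact: (ball_admissible_form X p1 q1 lambda lambda_ge1 n q r phi).
have t1 : t <= 1.
  exact: (bohr_bound_le1 X p1 q1 lambda lambda_ge1 q1_ge1 t X_neq0 tB).
have leDt : t <= sup D.
  apply: ub_le_sup; first by exists 1 => y [/andP[]].
  split; first by rewrite (ltW t0).
  exact: (disk_admissible_bohr_bound X p1 q1 lambda lambda_ge1 q1_ge1 t (ltW t0) tB).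
apply: (le_trans (power_mean n (r 0) q t n_gt0 r0 q_ge1 t0 Tt)).
rewrite powRM ?invr_ge0 ?ler0n ?(le_trans (ltW t0))// ler_wpM2r ?powR_ge0//.
(* As t <= 1 and 1/q <= 1, t is at most t^(1/q), which increases with t up to [sup D]. *)
apply: (@le_trans _ _ (t `^ q^-1)).
  by rewrite ger1_powR ?t0// invf_le1.
by rewrite ge0_ler_powR ?invr_ge0 ?nnegrE ?(ltW t0) ?(ltW q0)// (le_trans (ltW t0)).
Qed.
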